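(* For any complex-valued Banach limit $L:\ell^\infty\to\mathbb{C}$, we have $\|L\|_w=1$.
   Context: $\mathbb{N}=\{1,2,3,\dots\}$. $\ell^2$ is the complex Hilbert space of square-summable unilateral sequences, $\ell^\infty$ the complex Banach space of bounded complex sequences with the uniform norm $\|\cdot\|_\infty$, and $c$ the subspace of convergent complex sequences. $B:\ell^\infty\to\ell^\infty$ is the backward shift $(a_1,a_2,\dots)\mapsto(a_2,a_3,\dots)$, $\mathbb{1}=(1,1,\dots)$, and $a\ge0$ means $a_k\ge0$ for all $k$. For $a\in\ell^\infty$, the (unilateral) weighted forward shift $T_a:\ell^2\to\ell^2$ is the bounded operator $T_a(x_1,x_2,\dots)=(0,a_1x_1,a_2x_2,\dots)$. The numerical radius of a bounded operator $T$ on a complex Hilbert space $H$ is $w(T)=\sup\{|\langle Tx,x\rangle| : x\in H,\ \|x\|=1\}$. Set $\|a\|_w:=w(T_a)$, which is a norm on $\ell^\infty$. For a linear functional $\phi:\ell^\infty\to\mathbb{C}$, $\|\phi\|_w:=\sup\{|\phi(a)| : a\in\ell^\infty,\ \|a\|_w=1\}$. A (complex-valued) Banach limit is a linear functional $L:\ell^\infty\to\mathbb{C}$ such that: (1) $L(a)=L(Ba)$ for all $a\in\ell^\infty$; (2) $L(a)\ge0$ for all $a\in\ell^\infty$ with $a\ge0$; (3) $L(\mathbb{1})=1$ and $|L(a)|\le\|a\|_\infty$ for all $a\in\ell^\infty$; (4) $L(a)=\lim_{n\to\infty}a_n$ for all $a\in c$. *)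

(* Defs.v *)
From HB Require Import structures.
From mathcomp Require Import all_boot all_order all_algebra.
From mathcomp Require Import ring complex.
From mathcomp Require Import all_classical all_reals all_analysis.
Set Implicit Arguments.
Unset Strict Implicit.
Unset Printing Implicit Defensive.
Import Order.TTheory GRing.Theory Num.Theory.
Import numFieldNormedType.Exports.
Import ComplexField.Normc.
Local Open Scope classical_set_scope.
Local Open Scope ring_scope.

(* The usual norm topology on R[i], needed for limits of complex sequences.   *)
HB.instance Definition _ (R : realType) := NormedModule.copy R[i] R[i]^o.

(* Sequences are indexed by nat starting at 0: the entry a_k, k >= 1, of the  *)
(* mathematical text is [a k.-1]. Moduli are taken with the R-valued          *)
(* [normc z], since [`|z|] lives in R[i]; by definition [`|z|] is             *)
(* [(normc z)%:C].                                                            *)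

Section linf.
Variable R : realType.

Definition linf_pred : {pred nat -> R[i]} :=
  fun a => `[< exists M : R, forall n, normc (a n) <= M >].

Lemma linf_predP (a : nat -> R[i]) :
  reflect (exists M : R, forall n, normc (a n) <= M) (a \in linf_pred).
Proof. exact: asboolP. Qed.

Lemma linf_submod_closed : submod_closed linf_pred.
Proof.
split; first by apply/linf_predP; exists 0 => n; rewrite normc0.
move=> k a b /linf_predP[M aM] /linf_predP[N bN]; apply/linf_predP.
exists (normc k * M + N) => n; apply: (le_trans (le_normcD _ _)).
rewrite lerD// normcM ler_wpM2l//.
by case: k => u v; exact: sqrtr_ge0.
Qed.

HB.instance Definition _ :=
  GRing.isSubmodClosed.Build _ _ linf_pred linf_submod_closed.

Record linf := Linf { linf_seq :> nat -> R[i]; _ : linf_seq \in linf_pred }.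

HB.instance Definition _ := [isSub for linf_seq].
HB.instance Definition _ := [Choice of linf by <:].
HB.instance Definition _ := [SubChoice_isSubLmodule of linf by <:].

Definition linf_norm (a : linf) : R := sup (range (fun n => normc (a n))).

Lemma bshift_subproof (a : linf) : (fun n => a n.+1) \in linf_pred.
Proof.
by case: a => a /= /linf_predP[M aM]; apply/linf_predP; exists M => n.
Qed.

Definition bshift (a : linf) : linf := Linf (bshift_subproof a).

Lemma linf_one_subproof : (fun=> 1) \in linf_pred.
Proof. by apply/linf_predP; exists 1 => n; rewrite normc1. Qed.

Definition linf_one : linf := Linf linf_one_subproof.

End linf.

Section ell2.
Variable R : realType.

Definition ell2_pred : {pred nat -> R[i]} :=
  fun x => `[< cvgn (series (fun n => normc (x n) ^+ 2)) >].

Lemma ell2_predP (x : nat -> R[i]) :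
  reflect (cvgn (series (fun n => normc (x n) ^+ 2))) (x \in ell2_pred).
Proof. exact: asboolP. Qed.

Lemma ell2_submod_closed : submod_closed ell2_pred.
Proof.
split.
  apply/ell2_predP; rewrite (_ : series _ = cst 0); first exact: is_cvg_cst.
  apply/funext => n; apply: big1 => i _.
  by rewrite normc0 expr0n.
move=> k x y /ell2_predP cx /ell2_predP cy; apply/ell2_predP.
have nc_ge0 (z : R[i]) : 0 <= normc z by case: z => u v; exact: sqrtr_ge0.
pose f n := (normc k ^+ 2 *+ 2) * normc (x n) ^+ 2 + 2 * normc (y n) ^+ 2.
apply: (@series_le_cvg _ _ f).
- by move=> n; exact: sqr_ge0.
- by move=> n; rewrite addr_ge0// mulr_ge0// ?mulrn_wge0// sqr_ge0.
- move=> n; rewrite /f; set u := normc (x n); set v := normc (y n).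
  have h : normc ((k *: x + y) n) <= normc k * u + v.
    by apply: (le_trans (le_normcD _ _)); rewrite normcM.
  apply: (@le_trans _ _ ((normc k * u + v) ^+ 2)).
    rewrite ler_sqr// nnegrE; first exact: nc_ge0.
    by rewrite addr_ge0 ?mulr_ge0 //; exact: nc_ge0.
  rewrite -subr_ge0 [X in 0 <= X](_ : _ = (normc k * u - v) ^+ 2) ?sqr_ge0//.
  by rewrite !mulr2n; ring.
- have := is_cvg_seriesD (is_cvg_seriesZ (k := normc k ^+ 2 *+ 2) cx)
    (is_cvg_seriesZ (k := 2) cy).
  exact.
Qed.

HB.instance Definition _ :=
  GRing.isSubmodClosed.Build _ _ ell2_pred ell2_submod_closed.

Record ell2 := Ell2 { ell2_seq :> nat -> R[i]; _ : ell2_seq \in ell2_pred }.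

HB.instance Definition _ := [isSub for ell2_seq].
HB.instance Definition _ := [Choice of ell2 by <:].
HB.instance Definition _ := [SubChoice_isSubLmodule of ell2 by <:].

Definition ell2_inner (x y : ell2) : R[i] :=
  limn (series (fun n => x n * conjc (y n))).

Definition ell2_norm (x : ell2) : R :=
  Num.sqrt (limn (series (fun n => normc (x n) ^+ 2))).

(* Stated on ell2 only, and extended-real valued, so that no boundedness side *)
(* condition on T is needed.                                                  *)
Definition numerical_radius (T : {linear ell2 -> ell2}) : \bar R :=
  ereal_sup [set (normc (ell2_inner (T x) x))%:E | x in
    [set x | ell2_norm x = 1]].

End ell2.

Section weighted_shift.
Variables (R : realType) (a : linf R).

Definition wshift_seq (x : nat -> R[i]) (n : nat) : R[i] :=
  if n is m.+1 then a m * x m else 0.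

Lemma wshift_subproof (x : ell2 R) : wshift_seq x \in @ell2_pred R.
Proof.
case: x => x /= /ell2_predP cx; apply/ell2_predP.
have [M aM] : exists M : R, forall n, normc (a n) <= M.
  by case: a => b /= /linf_predP.
have nc_ge0 (z : R[i]) : 0 <= normc z by case: z => u v; exact: sqrtr_ge0.
have M0 : 0 <= M := le_trans (nc_ge0 _) (aM 0%N).
have c1 : cvgn (series (fun n => normc (a n * x n) ^+ 2)).
  apply: (@series_le_cvg _ _ (fun n => M ^+ 2 * normc (x n) ^+ 2)).
  - by move=> n; exact: sqr_ge0.
  - by move=> n; rewrite mulr_ge0// sqr_ge0.
  - by move=> n; rewrite normcM exprMn ler_wpM2r ?sqr_ge0// ler_sqr ?nnegrE.
  - exact: (is_cvg_seriesZ (k := M ^+ 2) cx).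
apply/cvg_ex; case/cvg_ex: c1 => l cl; exists l.
rewrite -cvg_shiftS [X in X @ _](_ : _ =
  series (fun n => normc (a n * x n) ^+ 2))//.
apply/funext => n; apply: (etrans (big_nat_recl _ _ _ (leq0n n))).
by rewrite normc0 expr0n add0r.
Qed.

Definition wshift (x : ell2 R) : ell2 R := Ell2 (wshift_subproof x).

Lemma wshift_linear : linear wshift.
Proof.
move=> k x y; apply: val_inj; apply/funext => -[|n].
  have e : 0 = k * 0 + 0 :> R[i] by rewrite mulr0 addr0.
  exact: e.
have e : a n * (k * x n + y n) = k * (a n * x n) + a n * y n by ring.
exact: e.
Qed.

HB.instance Definition _ :=
  GRing.isLinear.Build R[i] (ell2 R) (ell2 R) _ wshift wshift_linear.

End weighted_shift.

Section w_norms.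
Variable R : realType.

Definition wnorm (a : linf R) : \bar R := numerical_radius (wshift a).

Definition wnorm_dual (phi : {scalar linf R}) : \bar R :=
  ereal_sup [set (normc (phi a))%:E | a in [set a | wnorm a = 1%E]].

End w_norms.

Section banach_limits.
Variable R : realType.

(* In R[i], [0 <= z] means that z is real and nonnegative.                    *)
Record banach_limit (L : {scalar linf R}) : Prop := BanachLimit {
  banach_limit_shift : forall a : linf R, L a = L (bshift a);
  banach_limit_ge0 : forall a : linf R, (forall n, 0 <= a n) -> 0 <= L a;
  banach_limit_one : L (linf_one R) = 1;
  banach_limit_norm : forall a : linf R, normc (L a) <= linf_norm a;
  banach_limit_lim : forall (a : linf R) (l : R[i]),
    (a : nat -> R[i]) @ \oo --> l -> L a = l }.

End banach_limits.

(* Main.v *)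
Require Import Defs.
From mathcomp Require Import all_boot all_order all_algebra.
From mathcomp Require Import ring lra complex.
From mathcomp Require Import all_classical all_reals all_analysis.
Set Implicit Arguments.
Unset Strict Implicit.
Unset Printing Implicit Defensive.
Import Order.TTheory GRing.Theory Num.Theory.
Import numFieldNormedType.Exports.
Import ComplexField.Normc.
Local Open Scope classical_set_scope.
Local Open Scope ring_scope.

(** Fix N >= 1.  By shift invariance L a is also the value of L at the sequence of
    moving averages n |-> (a_n + ... + a_(n+N-1)) / N, hence |L a| is at most
    the supremum of the moduli of these averages.  On the other hand, let x be
    the unit vector that is constant on the N+1 indices n, ..., n+N and zero
    elsewhere.  Then <T_a x, x> = (a_n + ... + a_(n+N-1)) / (N+1), so every
    moving average is bounded by ((N+1)/N) w(T_a).  Letting N tend to infinity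
    gives |L a| <= w(T_a) ([banach_limit_le_wnorm]), that is, the dual norm of
    L is at most 1.

    It is attained at the constant sequence 1: the inequality itself yields
    1 = |L 1| <= w(T_1), while the arithmetic-geometric mean inequality gives
    w(T_a) <= sup |a_n| for every a ([wnorm_le_bound]), whence w(T_1) = 1. *)

Lemma normc_ge0 (R : realType) (z : R[i]) : 0 <= normc z.
Proof. by case: z => u v; exact: sqrtr_ge0. Qed.

Lemma normc_conjc (R : realType) (z : R[i]) : normc (conjc z) = normc z.
Proof. by case: z => u v; rewrite /= sqrrN. Qed.

Lemma normc_real (R : realType) (r : R) : normc r%:C%C = `|r|.
Proof. by rewrite /= expr0n addr0 sqrtr_sqr. Qed.

Lemma normc_nat (R : realType) (n : nat) : normc (n%:R : R[i]) = n%:R.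
Proof. by rewrite -(rmorph_nat (real_complex R)) normc_real normr_nat. Qed.

(** Closed balls are closed under limits; for a divergent sequence, [limn] is
    the default point 0 of R[i], which lies in the ball as well. *)
Lemma normc_lim_le (R : realType) (u : nat -> R[i]) (M : R) :
  (forall n, normc (u n) <= M) -> normc (limn u) <= M.
Proof.
move=> uM; have [cu|/dvgP ->] := pselect (cvgn u); last first.
  apply: le_trans (uM 0%N).
  by rewrite [X in normc X](_ : _ = 0)// normc0 normc_ge0.
rewrite leNgt; apply/negP => Ml.
have e0 : 0 < (normc (limn u) - M)%:C%C :> R[i] by rewrite ltcR subr_gt0.
have /cvgrPdist_lt/(_ _ e0)[K _ /(_ K (leqnn K))] := cu.
rewrite ltcR ltNge => /negP; apply.
rewrite lerBlDl (le_trans _ (lerD (uM K) (lexx _)))//.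
by rewrite (le_trans _ (le_normcD _ _))// addrC subrK.
Qed.

Lemma sum_window (V : nmodType) (g : nat -> V) (n p K : nat) : (p <= K)%N ->
  \sum_(0 <= k < K) (if (n <= k < p)%N then g k else 0) = \sum_(n <= k < p) g k.
Proof.
move=> pK; rewrite -big_mkcond/= (big_nat_widenl n 0)//.
rewrite (big_nat_widen _ _ _ _ _ pK).
by apply: eq_bigl => k; rewrite andbC.
Qed.

Lemma lim_series_window (K : numFieldType) (V : normedModType K)
    (g : nat -> V) (n p : nat) :
  series (fun k => if (n <= k < p)%N then g k else 0) @ \oo
    --> \sum_(n <= k < p) g k.
Proof. by apply: cvg_near_cst; exists p => // m /= pm; exact: sum_window. Qed.

(** The induction runs on a bound with one unpaired term |x_K|^2: each term of
    the form has modulus at most M |x_k x_(k+1)|, and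
    2 |x_k x_(k+1)| <= |x_k|^2 + |x_(k+1)|^2. *)
Lemma wshift_form_le (R : realType) (a : linf R) (M : R) (x : ell2 R) (K : nat) :
  (forall n, normc (a n) <= M) ->
  normc (\sum_(0 <= k < K.+1) wshift a x k * conjc (x k)) *+ 2 <=
  M * ((\sum_(0 <= k < K) normc (x k) ^+ 2) *+ 2 + normc (x K) ^+ 2).
Proof.
move=> aM; have M0 : 0 <= M := le_trans (normc_ge0 _) (aM 0%N).
elim: K => [|K IH].
  rewrite big_nat1 mul0r normc0 mul0rn mulr_ge0// big_geq// mul0rn add0r.
  exact: sqr_ge0.
rewrite big_nat_recr//= [X in _ <= M * (X *+ 2 + _)]big_nat_recr//=.
set S := \sum_(_ <= _ < _) _ in IH *; set P := \sum_(_ <= _ < _) _ in IH *.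
set u := normc (x K) in IH *; set v := normc (x K.+1).
have amgm : u * v *+ 2 <= u ^+ 2 + v ^+ 2.
  by rewrite -subr_ge0 [X in 0 <= X](_ : _ = (u - v) ^+ 2) ?sqr_ge0// mulr2n; ring.
have tM : normc (a K * x K * conjc (x K.+1)) *+ 2 <= M * (u ^+ 2 + v ^+ 2).
  rewrite !normcM normc_conjc -/u -/v -mulrA -mulrnAr.
  by apply: ler_pM; rewrite ?normc_ge0// mulrn_wge0// mulr_ge0// normc_ge0.
apply: (@le_trans _ _ ((normc S + normc (a K * x K * conjc (x K.+1))) *+ 2)).
  by rewrite lerMn2r; exact: le_normcD.
rewrite mulrnDl; apply: le_trans (lerD IH tM) _.
by rewrite -mulrDr; apply: ler_wpM2l => //; rewrite !mulr2n; lra.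
Qed.

Lemma wnorm_le_bound (R : realType) (a : linf R) (M : R) :
  (forall n, normc (a n) <= M) -> (wnorm a <= M%:E)%E.
Proof.
move=> aM; have M0 : 0 <= M := le_trans (normc_ge0 _) (aM 0%N).
apply: ge_ereal_sup => _ [x /= x1 <-]; rewrite lee_fin.
have /ell2_predP cx : (x : nat -> R[i]) \in @ell2_pred R by case: x {x1}.
have Px K : \sum_(0 <= k < K) normc (x k) ^+ 2 <= 1.
  have SE : limn (series (fun n => normc (x n) ^+ 2)) = 1.
    rewrite -[RHS](expr1n _ 2) -x1 sqr_sqrtr//.
    apply: limr_ge => //; apply: nearW => n.
    by apply: sumr_ge0 => k _; exact: sqr_ge0.
  rewrite -SE; apply: (nondecreasing_cvgn_le _ cx) => m n mn.
  rewrite /series/= (big_cat_nat (leq0n m) mn)/= lerDl.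
  by apply: sumr_ge0 => k _; exact: sqr_ge0.
apply: normc_lim_le => -[|K].
  by rewrite /series/= big_geq// normc0.
rewrite -(@ler_pMn2r _ 2)//; apply: (le_trans (wshift_form_le x K aM)).
rewrite -[leRHS]mulr_natr; apply: ler_wpM2l => //.
have := Px K; have := Px K.+1; rewrite big_nat_recr//= !mulr2n; lra.
Qed.

(** The test vectors for the lower bound on w(T_a): spread evenly over N+1
    consecutive coordinates and of norm 1. *)
Definition block_seq (R : realType) (n N k : nat) : R[i] :=
  if (n <= k < n + N.+1)%N then ((Num.sqrt N.+1%:R)^-1)%:C%C else 0.

Lemma block_normsq (R : realType) (n N : nat) :
  series (fun k => normc (block_seq R n N k) ^+ 2) @ \oo --> (1 : R).
Proof.
have -> : (fun k => normc (block_seq R n N k) ^+ 2) =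
    (fun k => if (n <= k < n + N.+1)%N then (N.+1%:R^-1 : R) else 0).
  apply/funext => k; rewrite /block_seq; case: ifP => _.
    by rewrite normc_real real_normK ?num_real// exprVn sqr_sqrtr.
  by rewrite normc0 expr0n.
have := @lim_series_window _ R^o (fun=> N.+1%:R^-1) n (n + N.+1).
by rewrite sumr_const_nat addKn -[_^-1 *+ _]mulr_natr mulVf ?pnatr_eq0//.
Qed.

Lemma block_subproof (R : realType) (n N : nat) :
  block_seq R n N \in @ell2_pred R.
Proof. by apply/ell2_predP/cvg_ex; exists 1; exact: block_normsq. Qed.

Definition block (R : realType) (n N : nat) : ell2 R := Ell2 (block_subproof R n N).

Lemma block_norm (R : realType) (n N : nat) : ell2_norm (block R n N) = 1.
Proof. by rewrite /ell2_norm (cvg_lim _ (block_normsq n N))// sqrtr1. Qed.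

(** The form is the sum of a_k x_k conj(x_(k+1)), so only the N pairs of adjacent
    coordinates inside the block count, although the block has N+1 entries. *)
Lemma block_form (R : realType) (a : linf R) (n N : nat) :
  ell2_inner (wshift a (block R n N)) (block R n N) =
  (\sum_(n <= k < n + N) a k) / N.+1%:R.
Proof.
(* The entry k of T_a x is a_(k-1) x_(k-1): the window is shifted by one. *)
rewrite /ell2_inner (_ : (fun k => _) = (fun k =>
    if (n.+1 <= k < (n + N).+1)%N then a k.-1 / N.+1%:R else 0)).
  rewrite (cvg_lim _ (@lim_series_window _ R[i] _ _ _)); last exact: norm_hausdorff.
  by rewrite big_add1/= mulr_suml.
apply/funext => -[|k] /=; first by rewrite mul0r.
rewrite /block_seq addnS !ltnS.
case: (leqP n k) => nk /=; last by rewrite mulr0 mul0r.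
rewrite (leq_trans nk (leqnSn k))/=.
case: (ltnP k (n + N)) => kN.
  rewrite (ltnW kN) -mulrA conjc_real -rmorphM -invfM -expr2 sqr_sqrtr//.
  by rewrite fmorphV rmorph_nat.
by rewrite rmorph0 mulr0.
Qed.

Lemma moving_average_le_wnorm (R : realType) (a : linf R) (n N : nat) :
  ((normc (\sum_(n <= k < n + N) a k) / N.+1%:R)%:E <= wnorm a)%E.
Proof.
apply: ereal_sup_ubound; exists (block R n N); first exact: block_norm.
by rewrite block_form normcM normcV normc_nat.
Qed.

(** A sum of shifts of a rather than a sequence of finite sums: in this form
    linearity and shift invariance of L apply at once. *)
Definition moving_sum (R : realType) (a : linf R) (N : nat) : linf R :=
  \sum_(j < N) iter j (@bshift R) a.

Lemma moving_sumE (R : realType) (a : linf R) (N n : nat) :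
  moving_sum a N n = \sum_(n <= k < n + N) a k.
Proof.
have iterE j b m : iter j (@bshift R) b m = b (m + j)%N.
  by elim: j m => [|j IH] m /=; rewrite ?addn0// IH addSnnS.
elim: N => [|N IH]; first by rewrite /moving_sum big_ord0 addn0 big_geq.
rewrite addnS big_nat_recr ?leq_addr//= -IH -iterE.
by rewrite /moving_sum big_ord_recr.
Qed.

Lemma banach_limit_moving_sum (R : realType) (L : {scalar linf R}) (a : linf R)
  (N : nat) : banach_limit L -> L (moving_sum a N) = L a *+ N.
Proof.
move=> BL; rewrite raddf_sum -[N in RHS]card_ord -sumr_const; apply: eq_bigr => j _.
by elim: (j : nat) => //= m <-; rewrite -(banach_limit_shift BL).
Qed.

Lemma ge_linf_norm (R : realType) (a : linf R) (M : R) :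
  (forall n, normc (a n) <= M) -> linf_norm a <= M.
Proof.
move=> aM; apply: ge_sup; first by exists (normc (a 0%N)), 0%N.
by move=> _ [n _ <-].
Qed.

(** The passage to the limit in c <= (N+1)/N r, in Archimedean form. *)
Lemma le_of_mulrn_le (R : realType) (c r : R) :
  (forall N, c *+ N <= r *+ N.+1) -> c <= r.
Proof.
move=> cr; rewrite leNgt; apply/negP => rc.
have d0 : 0 < c - r by rewrite subr_gt0.
have r0 : 0 <= r by have := cr 0%N; rewrite mulr0n mulr1n.
have := archi_boundP (divr_ge0 r0 (ltW d0)).
rewrite ltr_pdivrMr// mulr_natl mulrnBl ltrBrDr -mulrS => /lt_le_trans/(_ (cr _)).
by rewrite ltxx.
Qed.

(** The averaging argument: L a is the value of L at the moving averages of a,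
    and L is bounded by the supremum norm, here at most ((N+1)/N) w(T_a). *)
Lemma banach_limit_le_wnorm (R : realType) (L : {scalar linf R}) (a : linf R) :
  banach_limit L -> ((normc (L a))%:E <= wnorm a)%E.
Proof.
move=> BL; have := moving_average_le_wnorm a.
case: (wnorm a) => [r| |] aw; [|exact: leey|by have := aw 0%N 0%N].
rewrite lee_fin; apply: le_of_mulrn_le => N.
rewrite -normcMn -banach_limit_moving_sum//.
apply: le_trans (banach_limit_norm BL _) _; apply: ge_linf_norm => n.
by rewrite moving_sumE -[leRHS]mulr_natr -ler_pdivrMr// -lee_fin.
Qed.

Theorem corollary4p4 (R : realType) (L : {scalar linf R}) :
  banach_limit L -> wnorm_dual L = 1%E.
Proof.
move=> BL; have L1 : normc (L (linf_one R)) = 1.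
  by rewrite (banach_limit_one BL) normc1.
apply/eqP; rewrite eq_le; apply/andP; split.
  apply: ge_ereal_sup => _ [a /= a1 <-]; rewrite -a1.
  exact: banach_limit_le_wnorm.
apply: ereal_sup_ubound; exists (linf_one R); last by rewrite L1.
apply/eqP; rewrite eq_le; apply/andP; split.
  by apply: wnorm_le_bound => n; rewrite normc1.
by rewrite -[X in (X%:E <= _)%E]L1; exact: banach_limit_le_wnorm.
Qed.
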